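(* Let $D\subseteq\mathbb{C}$ be open and convex and let $f:D\to\mathbb{C}$ be a holomorphic function. Assume that there exist $w_1,w_2\in\mathbb{C}$ such that $\operatorname{Re} w_1\operatorname{Im} w_2\neq \operatorname{Re} w_2\operatorname{Im} w_1$ and for all $z\in D$ the following condition holds: $$\operatorname{Re}\left(f'(z)w_1\right)+\operatorname{Im}\left(f'(z)w_2\right)>|f'(z)|\,|w_2-iw_1|.$$ Then $f$ is univalent.
   Context: A holomorphic function which is also injective is called univalent. *)

(* Defs.v *)
From Stdlib Require Import Reals.
From Coquelicot Require Import Coquelicot.
Local Open Scope C_scope.

Definition convexC (D : C -> Prop) : Prop :=
  forall (x y : C) (t : R), D x -> D y -> (0 <= t <= 1)%R ->
    D (RtoC (1 - t) * x + RtoC t * y).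

(* A function on an open set D is represented by a total function on C; at a
   point of the open set D, differentiability and the derivative depend only on
   its values on D. The scalar field is given explicitly so that differentiability
   is complex and not real. *)
Definition holomorphic_on (D : C -> Prop) (f : C -> C) : Prop :=
  forall z : C, D z -> @ex_derive C_AbsRing C_NormedModule f z.

Definition injective_on (D : C -> Prop) (f : C -> C) : Prop :=
  forall x y : C, D x -> D y -> f x = f y -> x = y.

Definition univalent_on (D : C -> Prop) (f : C -> C) : Prop :=
  holomorphic_on D f /\ injective_on D f.

(* Main.v *)
(** Put [u = w1 - i w2].  The left-hand side of the condition is [Re (u f'(z))]
    and the right-hand side is nonnegative, so [Re (u f') > 0] on the convex set [D],
    and the Noshiro-Warschawski argument applies: if [f x = f y] with [x <> y], the
    mean value theorem for [t => Re (u / (y - x) * f (x + t (y - x)))] on [0, 1]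
    gives a point of [D] where [Re (u f') = 0]. *)

Require Import Defs.
From Stdlib Require Import Reals.
From Coquelicot Require Import Coquelicot.
From Stdlib Require Import Lra.
Local Open Scope R_scope.

(** Chain rule along a line: the first-order remainder of [f] over the increment [h * d], multiplied
    by [c], is [o(h)], and taking [Re] does not enlarge it. *)
Lemma derivable_pt_lim_Re_line (f : C -> C) (c p d l : C) (t : R) :
  @is_derive C_AbsRing C_NormedModule f (p + RtoC t * d)%C l ->
  derivable_pt_lim (fun s => Re (c * f (p + RtoC s * d))%C) t
    (Re (c * (l * d))%C).
Proof.
intros [_ Hf] eps Heps.
assert (Hc := Cmod_ge_0 c); assert (Hd := Cmod_ge_0 d).
(* The [+ 1] keeps the divisor positive when [c] or [d] is zero, and makes the final estimate
   strict. *)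
assert (Hk : 0 < Cmod c * Cmod d + 1) by nra.
assert (He : 0 < eps / (Cmod c * Cmod d + 1)) by (apply Rdiv_lt_0_compat; lra).
(* The identity proves that the neighbourhood filter of the base point converges to it. *)
destruct (Hf _ (fun P HP => HP) (mkposreal _ He)) as [delta Hdelta].
assert (Hdd : 0 < delta / (Cmod d + 1)).
{ apply Rdiv_lt_0_compat; [apply cond_pos | lra]. }
exists (mkposreal _ Hdd); intros h Hh0 Hh; simpl in Hh.
assert (Hha := Rabs_pos_lt _ Hh0).
set (z := (p + RtoC t * d)%C) in *.
set (z' := (p + RtoC (t + h) * d)%C).
assert (Hz : (z' - z = RtoC h * d)%C).
{ unfold z, z'; rewrite RtoC_plus; ring. }
assert (Hbound : Cmod (f z' - f z - RtoC h * d * l)%C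
                 <= eps / (Cmod c * Cmod d + 1) * (Rabs h * Cmod d)).
{ rewrite <- (Cmod_R h), <- (Cmod_mult (RtoC h)), <- Hz.
  apply (Hdelta z').
  change (Cmod (z' - z)%C < delta).
  rewrite Hz, Cmod_mult, Cmod_R.
  apply (Rmult_lt_compat_r (Cmod d + 1)) in Hh; [|lra].
  replace (delta / (Cmod d + 1) * (Cmod d + 1)) with (pos delta) in Hh
    by (field; lra).
  nra. }
(* As [h] is real, division by it commutes with [Re], so the error of the difference quotient is the
   scaled remainder's real part over [h]. *)
replace (_ - _) with (Re (c * (f z' - f z - RtoC h * d * l))%C / h).
2:{ unfold Re; simpl; field; exact Hh0. }
rewrite Rabs_div by exact Hh0.
apply Rlt_div_l; [exact Hha|].
eapply Rle_lt_trans; [apply re_le_Cmod|].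
rewrite Cmod_mult.
apply Rle_lt_trans with
  (Cmod c * (eps / (Cmod c * Cmod d + 1) * (Rabs h * Cmod d))).
{ now apply Rmult_le_compat_l. }
replace (eps * Rabs h)
  with (eps / (Cmod c * Cmod d + 1) * ((Cmod c * Cmod d + 1) * Rabs h))
  by (field; lra).
nra.
Qed.

Lemma noshiro_warschawski (D : C -> Prop) (f : C -> C) (u : C) :
  convexC D -> holomorphic_on D f ->
  (forall z, D z -> 0 < Re (u * C_derive f z)%C) ->
  injective_on D f.
Proof.
intros convexD holf Hpos x y Dx Dy Hxy.
destruct (Ceq_dec x y) as [|Hne]; [assumption | exfalso].
assert (Hd : (y - x)%C <> 0%C).
{ intros H0; apply Hne; symmetry.
  replace y with (y - x + x)%C by ring; rewrite H0; ring. }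
assert (Hseg : forall t, 0 <= t <= 1 -> D (x + RtoC t * (y - x))%C).
{ intros t Ht.
  replace (x + RtoC t * (y - x))%C with (RtoC (1 - t) * x + RtoC t * y)%C
    by (rewrite RtoC_minus; ring).
  now apply convexD. }
destruct (MVT_cor2
  (fun s => Re (u / (y - x) * f (x + RtoC s * (y - x)))%C)
  (fun s => Re (u / (y - x)
                * (C_derive f (x + RtoC s * (y - x)) * (y - x)))%C) 0 1)
  as [t [Ht Ht01]].
- lra.
- intros t Ht; apply derivable_pt_lim_Re_line, C_derive_correct;
    [exact x | now apply holf, Hseg].
- cbv beta in Ht.
  replace (x + RtoC 1 * (y - x))%C with y in Ht by ring.
  replace (x + RtoC 0 * (y - x))%C with x in Ht by ring.
  specialize (Hpos _ (Hseg t ltac:(lra))).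
  revert Ht Hpos; set (l := C_derive f _).
  (* The direction [y - x] produced by the chain rule cancels the denominator of the multiplier. *)
  replace (u / (y - x) * (l * (y - x)))%C with (u * l)%C by (field; exact Hd).
  rewrite Hxy; lra.
Qed.

Theorem corollary3p3 (D : C -> Prop) (f : C -> C)
  (openD : open D) (convexD : convexC D) (holf : holomorphic_on D f)
  (hw : exists w1 w2 : C,
     Re w1 * Im w2 <> Re w2 * Im w1 /\
     forall z : C, D z ->
       Re (C_derive f z * w1)%C + Im (C_derive f z * w2)%C
         > Cmod (C_derive f z) * Cmod (w2 - Ci * w1)%C) :
  univalent_on D f.
Proof.
split; [exact holf|].
destruct hw as [w1 [w2 [_ Hw]]].
apply (noshiro_warschawski D f (w1 - Ci * w2)%C convexD holf).
intros z Dz; specialize (Hw z Dz).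
assert (H0 := Rmult_le_pos _ _ (Cmod_ge_0 (C_derive f z))
                (Cmod_ge_0 (w2 - Ci * w1)%C)).
(* This is [Im v = Re (-i v)] for [v = f'(z) w2]. *)
replace (Re _) with (Re (C_derive f z * w1)%C + Im (C_derive f z * w2)%C).
- lra.
- unfold Re, Im; simpl; ring.
Qed.
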